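(* Let $G$ be a finite group, let $*$ be a nonidentical involutory antiautomorphism of $G$ with $gg^*\in Z(G)$ for every $g\in G$, and let $g_0\in Z(G)$ with $g_0^*=g_0$. Let $\beta\in\{xy,\,x^*y,\,yx,\,yx^*\}$, $\gamma\in\{xy,\,yx\}$ and $\delta\in\{g_0xy,\,g_0xy^*,\,g_0x^*y,\,g_0x^*y^*,\,g_0yx,\,g_0yx^*,\,g_0y^*x,\,g_0y^*x^*\}$. Then the loop $L=Q(G,*,g_0,\beta,\gamma,\delta)$ is an RC-loop if and only if at least one of the following holds: (a) $L$ is a C-loop; (b) $G/Z(G)$ is an elementary abelian $2$-group and $(\beta,\gamma,\delta)$ is among $(xy,yx,g_0xy)$, $(x^*y,xy,g_0yx^* )$, $(yx,xy,g_0yx)$, $(yx^*,yx,g_0x^*y)$; (c) $G$ is commutative, $(xx)^*=xx$ for every $x\in G$, and $(\beta,\gamma,\delta)$ is among $(xy,xy,g_0xy^* )$, $(x^*y,xy,g_0x^*y^* )$; (d) $G/Z(G)$ is an elementary abelian $2$-group, $(xx)^*=xx$ for every $x\in G$, and $(\beta,\gamma,\delta)$ is among $(xy,xy,g_0xy^* )$, $(xy,yx,g_0xy^* )$, $(x^*y,xy,g_0y^*x^* )$, $(x^*y,yx,g_0y^*x^* )$, $(yx,xy,g_0y^*x)$, $(yx,yx,g_0y^*x)$, $(yx^*,xy,g_0x^*y^* )$, $(yx^*,yx,g_0x^*y^* )$.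
   Context: $Z(G)$ is the center of $G$. An involutory antiautomorphism $*$ of $G$ satisfies $(g^* )^*=g$ and $(gh)^*=h^*g^*$; nonidentical means $g^*\neq g$ for some $g\in G$. A word such as $yx^*$ or $g_0y^*x$ denotes the function $G\times G\to G$ sending $(x,y)$ to the value of the word. Words are regarded as functions: two words are identified when they define the same function on $G\times G$ (for instance $xy$ and $yx$ when $G$ is commutative), and equality of triples $(\beta,\gamma,\delta)$ means equality of the three functions. Let $Gu=\{gu : g\in G\}$ be a disjoint copy of $G$. The loop $Q(G,*,g_0,\beta,\gamma,\delta)$ is the set $G\cup Gu$ with the multiplication, for $x,y\in G$, $$x\circ y=xy,\quad x\circ yu=\beta(x,y)u,\quad xu\circ y=\gamma(x,y)u,\quad xu\circ yu=\delta(x,y).$$ It is a loop with neutral element $1\in G$. The trivial group counts as an elementary abelian $2$-group. A loop is an RC-loop if it satisfies $x((yz)z)=(xy)(zz)$, and a C-loop if it satisfies $((xy)y)z=x(y(yz))$. *)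

(* Defs.v *)
From HB Require Import structures.
From mathcomp Require Import all_boot all_fingroup all_solvable.
Set Implicit Arguments.
Unset Strict Implicit.
Unset Printing Implicit Defensive.

Local Open Scope group_scope.

(* Finite functions, so that Leibniz equality (hence membership in a list) is
   equality of functions on G x G, not syntactic equality of words. *)
Definition word_fun (gT : finGroupType) := {ffun gT * gT -> gT}.

Definition word_of (gT : finGroupType) (f : gT -> gT -> gT) : word_fun gT :=
  [ffun p : gT * gT => f p.1 p.2].

Notation "[ 'word' x , y => E ]" := (word_of (fun x y => E))
  (at level 0, x name, y name, E at level 200,
   format "[ 'word'  x ,  y  =>  E ]").

Definition involutive_antiautomorphism (gT : finGroupType) (star : gT -> gT) :=
  involutive star /\ (forall g h : gT, star (g * h) = star h * star g).

(* The underlying set is gT + gT: inl x is x in G and inr x is xu in Gu. *)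
Definition Qmul (gT : finGroupType) (beta gamma delta : word_fun gT)
    (a b : gT + gT) : gT + gT :=
  match a, b with
  | inl x, inl y => inl (x * y)
  | inl x, inr y => inr (beta (x, y))
  | inr x, inl y => inr (gamma (x, y))
  | inr x, inr y => inl (delta (x, y))
  end.

Definition Qone (gT : finGroupType) : gT + gT := inl 1.

Definition is_loop (L : Type) (op : L -> L -> L) (e : L) :=
  [/\ left_id e op, right_id e op,
      forall a, bijective (fun x => op a x)
    & forall a, bijective (fun x => op x a)].

Definition RC_loop (L : Type) (op : L -> L -> L) (e : L) :=
  is_loop op e /\
  forall x y z, op x (op (op y z) z) = op (op x y) (op z z).

Definition C_loop (L : Type) (op : L -> L -> L) (e : L) :=
  is_loop op e /\
  forall x y z, op (op (op x y) y) z = op x (op y (op y z)).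

(* Main.v *)
(* Write x^0 = x, x^1 = x^*, and m_0(x,y) = xy, m_1(x,y) = yx.  The 64 triples are
   beta = m_w(x^s, y), gamma = m_v(x, y), delta = g0 m_t(x^a, y^b) for six bits.
   The instances of the RC law with some arguments equal to 1 or u force
     a = s,  b = 1 => (xx)^* = xx,  t = s + w mod 2 or G is commutative,
     all squares are central or s = w = v = b = 0,
   and the C law forces the same with b = 0.  Conversely, when squares are
   central, delta(z,z) = g0 z^s z^b is central and
   delta(beta(y,z),z) = beta(delta(y,z),z) = delta(z,z) y, from which every
   instance of the RC law follows; the C law needs v = t in addition.  If
   s = w = v = b = t = 0 the loop is a group. *)
Require Import Defs.
From mathcomp Require Import all_boot all_fingroup all_solvable.
Set Implicit Arguments.
Unset Strict Implicit.
Unset Printing Implicit Defensive.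
Local Open Scope group_scope.

(** * Centrality and elementary abelian quotients *)

Definition central (gT : finGroupType) (c : gT) := forall x, c * x = x * c.

Lemma center_setT (gT : finGroupType) (c : gT) :
  c \in 'Z([set: gT]) <-> central c.
Proof.
split=> [/centerP[_ cC] x | cC]; first by apply: cC; rewrite inE.
by apply/centerP; split=> // x _; apply: cC.
Qed.

Lemma abelian_setT (gT : finGroupType) :
  abelian [set: gT] <-> forall c : gT, central c.
Proof.
split=> [cGG c x | cC]; first by apply: (centsP cGG); rewrite inE.
by apply/centsP=> x _ y _; apply: cC.
Qed.

(** Commutativity of the quotient comes for free: if all squares in it are trivial, every element is
    its own inverse, so uv = (uv)^-1 = v^-1 u^-1 = vu. *)
Lemma abelem2_central_quotient (gT : finGroupType) :
  2.-abelem ([set: gT] / 'Z([set: gT])) <-> forall x : gT, central (x * x).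
Proof.
have nZ (x : gT) : x \in 'N('Z([set: gT])).
  by rewrite (subsetP (normal_norm (center_normal _))) ?inE.
split=> [/abelemP[] // _ sq1 x | sqC].
  apply/center_setT; rewrite -expg2 coset_idr ?groupX //.
  by rewrite morphX // sq1 // mem_quotient ?inE.
have sq1 u : u \in [set: gT] / 'Z([set: gT]) -> u * u = 1.
  case/morphimP=> x Nx _ ->; rewrite -morphM //.
  by apply: coset_id; apply/center_setT.
apply/abelemP=> //; split=> [|u]; last by rewrite expg2; apply: sq1.
apply/centsP=> u Gu v Gv; have inv t : t \in [set: gT] / 'Z([set: gT]) -> t^-1 = t.
  by move=> /sq1 tt; apply: (mulgI t); rewrite mulgV tt.
by rewrite /commute -[LHS]inv ?groupM // invMg !inv.
Qed.

(** * The 64 triples of words and the calculus of their bits *)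

Section Words.

Variables (gT : finGroupType) (star : gT -> gT) (g0 : gT).
Hypotheses (starK : involutive star)
           (starM : forall g h, star (g * h) = star h * star g)
           (starC : forall g, central (g * star g))
           (star_nonid : exists g, star g <> g)
           (g0C : central g0) (star_g0 : star g0 = g0).

Implicit Types (s w v a b t : bool) (c x y z : gT).

Definition tw s x := if s then star x else x.
Definition mw w x y := if w then y * x else x * y.

Definition beta_word s w := [word x, y => mw w (tw s x) y].
Definition gamma_word v := [word x, y => mw v x y].
(** The bracketing is that of the listed words, so fixing the bits yields one of them by
    computation; [delta_wordE] gives the form used in calculations. *)
Definition delta_word a b t :=
  [word x, y => if t then g0 * tw b y * tw a x else g0 * tw a x * tw b y].

Lemma beta_wordE s w x y : beta_word s w (x, y) = mw w (tw s x) y.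
Proof. by rewrite ffunE. Qed.

Lemma gamma_wordE v x y : gamma_word v (x, y) = mw v x y.
Proof. by rewrite ffunE. Qed.

Lemma delta_wordE a b t x y :
  delta_word a b t (x, y) = g0 * mw t (tw a x) (tw b y).
Proof. by rewrite ffunE; case: t; rewrite /= mulgA. Qed.

Definition wordE := (beta_wordE, gamma_wordE, delta_wordE).

Lemma star1 : star 1 = 1.
Proof. by apply: (mulgI (star 1)); rewrite -starM !mulg1. Qed.

Lemma tw1 s : tw s 1 = 1.
Proof. by case: s => //=; apply: star1. Qed.

Lemma twK s : involutive (tw s).
Proof. by case: s => // x; apply: starK. Qed.

Lemma twtw s s' x : tw s (tw s' x) = tw (s (+) s') x.
Proof. by case: s s' => [] [] //=; apply: starK. Qed.

(** [star] reverses products, so a twist by [s] adds [s] to the order bit; this is the source of the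
    condition t = s + w mod 2. *)
Lemma tw_mw s w x y : tw s (mw w x y) = mw (w (+) s) (tw s x) (tw s y).
Proof. by case: s w => [] [] //=; rewrite starM. Qed.

(** Since [star] moves some element, an identity between group elements determines a bit. *)
Lemma tw_eq_id s : (forall x, tw s x = x) -> s = false.
Proof. by case: s => // id_star; case: star_nonid => g []; apply: id_star. Qed.

Lemma mw1 w x : (mw w x 1 = x) * (mw w 1 x = x).
Proof. by case: w; rewrite /= mulg1 mul1g. Qed.

Lemma mw_inj w : left_injective (mw w) * right_injective (mw w).
Proof.
by case: w; split=> x y z /=;
  [apply: mulgI | apply: mulIg | apply: mulIg | apply: mulgI].
Qed.

Lemma centralM c c' : central c -> central c' -> central (c * c').
Proof. by move=> cC c'C x; rewrite -mulgA c'C !mulgA cC. Qed.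

Lemma central_tw s c : central c -> central (tw s c).
Proof.
case: s => //= cC x.
by apply: (can_inj starK); rewrite !starM starK cC.
Qed.

Lemma mw_centralr w x c : central c -> mw w x c = c * x.
Proof. by case: w => //= ->. Qed.

Lemma mwMl w x y c : central c -> mw w (c * x) y = c * mw w x y.
Proof. by case: w => cC /=; rewrite ?mulgA // cC. Qed.

Lemma mwMr w x y c : central c -> mw w x (c * y) = c * mw w x y.
Proof. by case: w => cC /=; rewrite !mulgA // cC. Qed.

Lemma twM s x c : central c -> tw s (c * x) = tw s c * tw s x.
Proof. by case: s => //= cC; rewrite cC starM. Qed.

(** Cancel [x] in x(star x x) = (x star x)x = x(x star x), where the last step is centrality of
    [x * star x]. *)
Lemma star_comm x : star x * x = x * star x.
Proof. by apply: (mulgI x); rewrite mulgA starC. Qed.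

Lemma tw_comm s s' x : tw s x * tw s' x = tw s' x * tw s x.
Proof. by case: s s' => [] [] //=; rewrite star_comm. Qed.

Lemma mw_tw_diag w s s' x : mw w (tw s x) (tw s' x) = tw s x * tw s' x.
Proof. by case: w => //=; apply: tw_comm. Qed.

(** By finiteness it suffices that translations are injective, and each word is injective in each
    argument. *)
Lemma Qmul_is_loop s w v a b t :
  is_loop (Qmul (beta_word s w) (gamma_word v) (delta_word a b t)) (Qone gT).
Proof.
split=> [[x|x]|[x|x]|p|p] /=; rewrite ?wordE ?tw1 ?mw1 ?mul1g ?mulg1 //.
- apply: injF_bij; case: p => p [x|x] [y|y] //= []; rewrite ?wordE => eqxy; congr (_ _).
  + exact: mulgI eqxy.
  + exact: (mw_inj w).2 eqxy.
  + exact: (mw_inj v).2 eqxy.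
  + exact: (can_inj (twK b)) ((mw_inj t).2 _ _ _ (mulgI _ _ _ eqxy)).
- apply: injF_bij; case: p => p [x|x] [y|y] //= []; rewrite ?wordE => eqxy; congr (_ _).
  + exact: mulIg eqxy.
  + exact: (mw_inj v).1 eqxy.
  + exact: (can_inj (twK s)) ((mw_inj w).1 _ _ _ eqxy).
  + exact: (can_inj (twK a)) ((mw_inj t).1 _ _ _ (mulgI _ _ _ eqxy)).
Qed.

(** * Sufficiency of the bit conditions when squares are central *)

Section CentralSquares.

Hypothesis sqC : forall x, central (x * x).

Lemma tw_sq_central s s' x : central (tw s x * tw s' x).
Proof.
case: s s' => [] [] //=.
by rewrite star_comm; apply: starC.
Qed.

(** The square of zu when a = s: a central element that plays for zu the role of zz. *)
Let N s b z := g0 * (tw s z * tw b z).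

Lemma delta_diag s b t z : delta_word s b t (z, z) = N s b z.
Proof. by rewrite wordE mw_tw_diag. Qed.

Lemma N_central s b z : central (N s b z).
Proof. by apply: centralM => //; apply: tw_sq_central. Qed.

Lemma mw_tw_tw w s b y z :
  mw w (mw w y (tw s z)) (tw b z) = tw s z * tw b z * y.
Proof.
case: w => /=; first by rewrite mulgA (tw_comm b).
by rewrite tw_sq_central mulgA.
Qed.

Lemma mw_sq w y z : mw w (mw w y z) z = z * z * y.
Proof. exact: (mw_tw_tw w false false). Qed.

(** For s and b distinct, [N] is [g0] times z star z, which [star] fixes anyway; for s = b it is
    [g0] times a square. *)
Lemma star_N s b z :
  (s = b -> forall x, star (x * x) = x * x) -> star (N s b z) = N s b z.
Proof.
move=> sqF; rewrite /N starM star_g0 g0C; congr (_ * g0).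
case: s b sqF => [] [] /= sqF; rewrite ?starM ?starK // ?star_comm //.
  by rewrite -starM sqF.
by rewrite -starM sqF.
Qed.

(** The twist by [s] restores [y] and changes the order bit from w to s + w = t, so both copies of
    [z] stand on the same side of [y] and merge into a central factor. *)
Lemma delta_beta s b w t y z : t = s (+) w ->
  delta_word s b t (beta_word s w (y, z), z) = N s b z * y.
Proof.
by move=> ->; rewrite !wordE tw_mw twK (addbC s w) mw_tw_tw /N -!mulgA.
Qed.

Lemma beta_delta s b w t y z :
    t = s (+) w -> (b -> forall x, star (x * x) = x * x) ->
  beta_word s w (delta_word s b t (y, z), z) = N s b z * y.
Proof.
move=> -> sqF; rewrite !wordE twM // tw_mw twK twtw addbAC addbb addFb.
rewrite mwMl; last exact: central_tw.
rewrite (mw_tw_tw w _ false) /N -[RHS]mulgA.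
have -> : tw s g0 = g0 by case: (s).
(* Only s = b = 1 needs squares to be fixed: there zz is compared with its image under [star]. *)
congr (_ * (_ * _)); case: s b sqF => [] [] //= sqF.
  by rewrite -starM sqF.
exact: star_comm.
Qed.

Lemma RC_loop_bits s b w t v :
    t = s (+) w -> (b -> forall x, star (x * x) = x * x) ->
  RC_loop (Qmul (beta_word s w) (gamma_word v) (delta_word s b t)) (Qone gT).
Proof.
move=> tE sqF; split=> [|[x|x] [y|y] [z|z] /=]; first exact: Qmul_is_loop.
all: congr (_ _).
(* Eight cases, by whether x, y, z lie in G or Gu. After the first, multiplying twice by z produces
   a central factor, zz or [N], which is moved out of the words. *)
- by rewrite !mulgA.
- by rewrite delta_beta // delta_diag N_central mulgA.
- by rewrite !wordE mw_sq mwMr // [RHS]mw_centralr.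
- by rewrite beta_delta // delta_diag !wordE mwMr ?[RHS]mw_centralr //; apply: N_central.
- by rewrite !wordE -mulgA -sqC mwMr // [RHS]mw_centralr.
- by rewrite delta_beta // delta_diag !wordE mwMr ?[RHS]mw_centralr //; apply: N_central.
(* With x and y both in Gu, the central factor passes through the twist [b] of delta, so [star] must
   fix it when b = 1. *)
- rewrite !wordE mw_sq twM // mwMr; last exact: central_tw.
  rewrite -sqC !mulgA -[g0 * _]central_tw //; case: (b) sqF => //= -> //.
- rewrite beta_delta // !wordE twM; last exact: N_central.
  rewrite mwMr ?mw_tw_diag; last exact/central_tw/N_central.
  have -> : tw b (N s b z) = N s b z.
    by case: (b) sqF => //= sqF; apply: star_N => _; apply: sqF.
  rewrite -/(N s b z) N_central !mulgA; congr (_ * _); exact: g0C.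
Qed.

(** With v = t and b = 0, gamma(y,z) and delta(y,z) put their first argument on the same side of z,
    so left multiplying twice by yu gives the factor [N]. The other side of the law is handled by
    [delta_beta] and [beta_delta]. *)
Lemma C_loop_bits s w t v :
    t = s (+) w -> v = t ->
  C_loop (Qmul (beta_word s w) (gamma_word v) (delta_word s false t)) (Qone gT).
Proof.
move=> tE vt.
have sqyC y : central (tw s y * y) := tw_sq_central s false y.
have sy y : y * tw s y = tw s y * y := tw_comm false s y.
have delta_gamma y z :
    delta_word s false t (y, gamma_word v (y, z)) = N s false y * z.
  rewrite vt !wordE /N -mulgA; congr (_ * _); case: (t) => /=.
    by rewrite -mulgA sy sqyC.
  by rewrite mulgA.
have gamma_delta y z :
    gamma_word v (y, delta_word s false t (y, z)) = N s false y * z.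
  rewrite vt !wordE mwMr // /N -mulgA; congr (_ * _); case: (t) => /=.
    by rewrite -mulgA sqyC.
  by rewrite mulgA sy.
have beta_beta y z :
    beta_word s w (y, beta_word s w (y, z)) = tw s y * tw s y * z.
  by rewrite !wordE; case: (w); rewrite /= ?mulgA // -mulgA tw_sq_central.
have tw_sq y : tw s (y * y) = tw s y * tw s y by case: (s); rewrite //= starM.
have twN y : tw s (N s false y) = N s false y.
  by case: (s) => //=; apply: star_N.
have NC := N_central s false.
split=> [|[x|x] [y|y] [z|z] /=]; first exact: Qmul_is_loop.
all: congr (_ _).
- by rewrite !mulgA.
- rewrite beta_beta !wordE -mulgA -sqC twM // tw_sq.
  by rewrite mwMl ?mwMr //; apply: tw_sq_central.
- by rewrite delta_beta // delta_gamma NC -mulgA.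
- by rewrite delta_beta // gamma_delta !wordE twM // twN mwMl // mwMr.
- by rewrite !wordE mw_sq mulgA mwMl // mwMr.
- rewrite beta_beta !wordE mw_sq twM // tw_sq.
  by rewrite mwMl ?mwMr //; apply: tw_sq_central.
- by rewrite beta_delta // delta_gamma !wordE mwMl // mwMr.
- by rewrite beta_delta // gamma_delta !wordE twM // twN mwMl // mwMr.
Qed.

End CentralSquares.

(** With all bits zero the loop is the extension of G by a central u with uu = [g0]. *)
Lemma Qmul_assoc :
  associative (Qmul (beta_word false false) (gamma_word false)
                    (delta_word false false false)).
Proof.
move=> [x|x] [y|y] [z|z] /=; congr (_ _); rewrite ?wordE /= ?mulgA //.
all: by rewrite -g0C ?mulgA.
Qed.

Lemma beta_word_comm s w w' :
  (forall c, central c) -> beta_word s w = beta_word s w'.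
Proof.
move=> cC; apply/ffunP=> -[x y]; rewrite !wordE.
by rewrite !(mw_centralr _ _ (cC _)).
Qed.

Lemma gamma_word_comm v v' :
  (forall c, central c) -> gamma_word v = gamma_word v'.
Proof.
move=> cC; apply/ffunP=> -[x y]; rewrite !wordE.
by rewrite !(mw_centralr _ _ (cC _)).
Qed.

Lemma delta_word_comm a b t t' :
  (forall c, central c) -> delta_word a b t = delta_word a b t'.
Proof.
move=> cC; apply/ffunP=> -[x y]; rewrite !wordE.
by rewrite !(mw_centralr _ _ (cC _)).
Qed.

(** * The RC law and the C law as conditions on the bits *)

Section Bits.

Variables s w v a b t : bool.

Let beta := beta_word s w.
Let gamma := gamma_word v.
Let delta := delta_word a b t.
Local Notation op := (Qmul beta gamma delta).

(** For commutative G the order bit [t] may be reset to s + w. If squares are not known to be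
    central, all bits vanish and associativity applies. *)
Lemma RC_loop_of_bits :
    a = s -> t = s (+) w \/ (forall c, central c) ->
    (b -> forall x, star (x * x) = x * x) ->
    (forall x, central (x * x)) \/ [|| s, w, v | b] = false ->
  RC_loop op (Qone gT).
Proof.
rewrite /beta /gamma /delta => -> tE sqF sqC.
have -> : delta_word s b t = delta_word s b (s (+) w).
  by case: tE => [->//|cC]; apply: delta_word_comm.
case: sqC => [sqC|]; first exact: RC_loop_bits.
case: (s) (w) (v) (b) => [] [] [] [] //= _; split; first exact: Qmul_is_loop.
by move=> x y z; rewrite !Qmul_assoc.
Qed.

Lemma C_loop_of_bits :
    a = s -> b = false -> t = s (+) w /\ v = t \/ (forall c, central c) ->
    (forall x, central (x * x)) \/ [|| s, w, v | b] = false ->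
  C_loop op (Qone gT).
Proof.
rewrite /beta /gamma /delta => -> -> tE sqC.
have [-> ->] : delta_word s false t = delta_word s false (s (+) w)
    /\ gamma_word v = gamma_word (s (+) w).
  case: tE => [[-> ->]//|cC]; split.
    exact: delta_word_comm.
  exact: gamma_word_comm.
case: sqC => [sqC|]; first exact: C_loop_bits.
case: (s) (w) => [] [] //= _; split; first exact: Qmul_is_loop.
by move=> x y z; rewrite !Qmul_assoc.
Qed.

Lemma tw_delta_beta :
  (forall x y, delta (beta (x, y), y) = x * delta (y, y)) -> a = s.
Proof.
rewrite /beta /delta => dbE; apply/eqP; rewrite -negb_add; apply/negbT.
(* At y = 1 the identity reduces to [tw (a (+) s) x = x]. *)
apply: tw_eq_id => x; have := dbE x 1.
by rewrite !wordE !tw1 !mw1 mulg1 twtw -g0C => /mulgI.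
Qed.

Lemma delta_beta_inv :
    a = s -> (forall x y, delta (beta (x, y), y) = x * delta (y, y)) ->
  t = s (+) w \/ forall c, central c.
Proof.
rewrite /beta /delta => -> dbE.
have mwE x y : mw t (mw (w (+) s) x (tw s y)) (tw b y) = x * (tw s y * tw b y).
  have := dbE x y; rewrite !wordE tw_mw twK mw_tw_diag.
  by rewrite [RHS]mulgA -g0C -[RHS]mulgA => /mulgI.
have [tE|neq_t] := eqVneq t (s (+) w); [by left | right=> c x].
(* Write c' for c twisted by s + b. If t = 0, the choice y = [tw s c] gives cxc' = xcc'; if t = 1, y
   = [tw b c] gives cxc' = xc'c. As c and c' commute, cancelling c' gives cx = xc. *)
have := mwE x (tw b c); have := mwE x (tw s c); rewrite !twK !twtw.
have /= -> := tw_comm (s (+) b) false c.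
move: neq_t; rewrite (addbC w); case: (t) (s (+) w) => [] [] //= _.
  by move=> _; rewrite mulgA [RHS]mulgA => /mulIg.
by move=> + _; rewrite [RHS]mulgA => /mulIg.
Qed.

Lemma bits_of_RC_loop :
    RC_loop op (Qone gT) ->
  [/\ a = s, t = s (+) w \/ (forall c, central c),
      (b -> forall x, star (x * x) = x * x)
    & (forall x, central (x * x)) \/ [|| s, w, v | b] = false].
Proof.
case=> _ rc.
have dbE x y : delta (beta (x, y), y) = x * delta (y, y).
  by have [] := rc (inl 1) (inl x) (inr y); rewrite !mul1g.
have as_ := tw_delta_beta dbE.
have tE := delta_beta_inv as_ dbE.
have twb y z : tw b (mw v (mw v y z) z) = tw b y * (z * z).
  have [] := rc (inr 1) (inr y) (inl z).
  by rewrite !wordE tw1 !mw1 -mulgA => /mulgI.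
have sqF : b -> forall x, star (x * x) = x * x.
  by move=> bT z; have := twb 1 z; rewrite bT mw1 tw1 mul1g; case: (v).
split=> //.
(* For each nonzero bit in turn, some instance has zz on opposite sides of y in its two members. *)
have [vT|vF] := boolP v.
  left=> z y; have [] := rc (inr 1) (inl y) (inl z).
  by rewrite /gamma vT !wordE /= !mulg1 mulgA.
have [wT|wF] := boolP w.
  left=> z y; have [] := rc (inl (tw s y)) (inr 1) (inl z).
  by rewrite /beta /gamma wT (negPf vF) !wordE !twK /= !mul1g.
have [bT|bF] := boolP b.
  left=> z y; have := twb (star y) z; rewrite bT (negPf vF) /= starK => <-.
  by rewrite -[_ * z * z]mulgA [RHS]starM sqF // starK.
have [sT|sF] := boolP s; last by right.
(* Here t = 1, and the instance reads g0 zz y = g0 y zz. *)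
case: tE => [tT|]; last by left.
left=> z y; have [] := rc (inr (tw a y)) (inr 1) (inl z).
rewrite !wordE (negPf bF) (negPf vF) tT sT (negPf wF) twK /= !mul1g.
by rewrite mulgA -[RHS]mulgA -[LHS]mulgA => /mulgI.
Qed.

Lemma bits_of_C_loop :
    C_loop op (Qone gT) ->
  [/\ a = s, b = false, t = s (+) w \/ (forall c, central c)
    & (forall x, central (x * x)) \/ [|| s, w, v | b] = false].
Proof.
case=> _ cl.
(* The C law at x, yu, 1 gives the identity that the RC law gives at 1, x, yu. *)
have dbE x y : delta (beta (x, y), y) = x * delta (y, y).
  have [] := cl (inl x) (inr y) (inl 1).
  by rewrite /gamma wordE mw1 mulg1.
have as_ := tw_delta_beta dbE.
have tE := delta_beta_inv as_ dbE.
have bF : b = false.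
  (* The instance 1, u, z compares g0 z with g0 times z twisted by [b]. *)
  apply: tw_eq_id => z; have [] := cl (inl 1) (inr 1) (inl z).
  by rewrite !wordE !tw1 !mw1 tw1 mul1g mulg1 => /mulgI.
split=> //; rewrite bF.
have [vT|vF] := boolP v.
  left=> y z; have [] := cl (inr 1) (inl y) (inl z).
  by rewrite /gamma vT !wordE /= !mulg1 mulgA => ->; rewrite mulgA.
have sq_tw x y : tw s (x * y * y) = mw w (tw s x) (tw s y * tw s y).
  have [] := cl (inl x) (inl y) (inr 1).
  by rewrite !wordE !mw1 mw_tw_diag.
have sq_tw_central : (forall y, central (tw s y * tw s y)) ->
    forall y, central (y * y).
  by move=> sqC y; rewrite -(twK s y).
have [wT|wF] := boolP w; have [sT|sF] := boolP s; last by right.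
(* For s = w = 1 the identity [sq_tw] is vacuous, so an instance with first argument in Gu is
   used. *)
- left; apply: sq_tw_central => y x.
  have [] := cl (inr (tw s x)) (inl y) (inr 1).
  rewrite !wordE as_ wT sT (negPf vF) !tw1 bF !mw1 /= !starM starK.
  move=> /mulgI; rewrite mulgA.
  case: tE => [->|cC _]; first by rewrite sT wT.
  exact: cC.
- left=> y x; have := sq_tw x y.
  by rewrite wT (negPf sF) /= -mulgA.
- left; apply: sq_tw_central => y x; have := sq_tw (tw s x) y.
  by rewrite sT (negPf wF) /= !starM starK mulgA.
Qed.

End Bits.
End Words.

(** * Matching the bits with the listed triples *)

Theorem theorem8p8 (gT : finGroupType) (star : gT -> gT) (g0 : gT)
    (beta gamma delta : word_fun gT)
    (star_anti : involutive_antiautomorphism star)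
    (star_nonid : exists g : gT, star g <> g)
    (star_central : forall g : gT, g * star g \in 'Z([set: gT]))
    (g0_central : g0 \in 'Z([set: gT]))
    (star_g0 : star g0 = g0)
    (beta_in : beta \in
       [:: [word x, y => x * y]; [word x, y => star x * y];
           [word x, y => y * x]; [word x, y => y * star x]])
    (gamma_in : gamma \in [:: [word x, y => x * y]; [word x, y => y * x]])
    (delta_in : delta \in
       [:: [word x, y => g0 * x * y]; [word x, y => g0 * x * star y];
           [word x, y => g0 * star x * y]; [word x, y => g0 * star x * star y];
           [word x, y => g0 * y * x]; [word x, y => g0 * y * star x];
           [word x, y => g0 * star y * x]; [word x, y => g0 * star y * star x]]) :
  RC_loop (Qmul beta gamma delta) (Qone gT) <->
  [\/ C_loop (Qmul beta gamma delta) (Qone gT),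
      2.-abelem ([set: gT] / 'Z([set: gT])) /\
      (beta, gamma, delta) \in
        [:: ([word x, y => x * y], [word x, y => y * x],
             [word x, y => g0 * x * y]);
            ([word x, y => star x * y], [word x, y => x * y],
             [word x, y => g0 * y * star x]);
            ([word x, y => y * x], [word x, y => x * y],
             [word x, y => g0 * y * x]);
            ([word x, y => y * star x], [word x, y => y * x],
             [word x, y => g0 * star x * y])],
      [/\ abelian [set: gT],
          forall x : gT, star (x * x) = x * x
        & (beta, gamma, delta) \in
          [:: ([word x, y => x * y], [word x, y => x * y],
               [word x, y => g0 * x * star y]);
              ([word x, y => star x * y], [word x, y => x * y],
               [word x, y => g0 * star x * star y])]]
    | [/\ 2.-abelem ([set: gT] / 'Z([set: gT])),
          forall x : gT, star (x * x) = x * x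
        & (beta, gamma, delta) \in
          [:: ([word x, y => x * y], [word x, y => x * y],
               [word x, y => g0 * x * star y]);
              ([word x, y => x * y], [word x, y => y * x],
               [word x, y => g0 * x * star y]);
              ([word x, y => star x * y], [word x, y => x * y],
               [word x, y => g0 * star y * star x]);
              ([word x, y => star x * y], [word x, y => y * x],
               [word x, y => g0 * star y * star x]);
              ([word x, y => y * x], [word x, y => x * y],
               [word x, y => g0 * star y * x]);
              ([word x, y => y * x], [word x, y => y * x],
               [word x, y => g0 * star y * x]);
              ([word x, y => y * star x], [word x, y => x * y],
               [word x, y => g0 * star x * star y]);
              ([word x, y => y * star x], [word x, y => y * x],
               [word x, y => g0 * star x * star y])]]].
Proof.
have [starK starM] := star_anti.
have starC g : central (g * star g) by apply/center_setT.
have g0C : central g0 by apply/center_setT.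
have [s [w bE]] : exists s w, beta = beta_word star s w.
  move: beta_in; rewrite !inE => /or4P[]/eqP->.
  - by exists false, false.
  - by exists true, false.
  - by exists false, true.
  - by exists true, true.
have [v cE] : exists v, gamma = gamma_word gT v.
  by move: gamma_in; rewrite !inE => /orP[]/eqP->; [exists false | exists true].
have [a [b [t dE]]] : exists a b t, delta = delta_word star g0 a b t.
  move: delta_in; rewrite !inE => /orP[/eqP->|]; first by exists false, false, false.
  case/orP=> [/eqP->|]; first by exists false, true, false.
  case/orP=> [/eqP->|]; first by exists true, false, false.
  case/orP=> [/eqP->|]; first by exists true, true, false.
  case/or4P=> /eqP->.
  - by exists false, false, true.
  - by exists true, false, true.
  - by exists false, true, true.
  - by exists true, true, true.
have RC_bits := RC_loop_of_bits starK starM starC g0C star_g0.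
have C_bits := C_loop_of_bits starK starM starC g0C star_g0.
split=> [rc | [clp | [/abelem2_central_quotient sqC] | [/abelian_setT cC sqF]
                  | [/abelem2_central_quotient sqC sqF]]].
- move: rc; rewrite {}bE {}cE {}dE.
  case/bits_of_RC_loop => // as_ tE sqF sqC.
  (* For commutative G the order bits do not change the functions: b = 0 gives a C-loop, and b = 1
     leaves only [s] free, which gives the two triples of (c). *)
  have [cGG|ncGG] := boolP (abelian [set: gT]).
    have cC := (abelian_setT gT).1 cGG.
    case: b sqF sqC => [/(_ isT) sqF _ | _ sqC]; last first.
      by apply/Or41/C_bits => //; right.
    apply: Or43; split=> //.
    rewrite (beta_word_comm _ s w false cC) (gamma_word_comm v false cC).
    rewrite (delta_word_comm _ _ a true t false cC) as_ !inE.
    by case: (s); rewrite eqxx ?orbT.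
  case: tE => [tE|cC]; last by case/negP: ncGG; apply/abelian_setT.
  (* Now t = s + w. If b = 1, the free bits s, w, v give the eight triples of (d); if b = 0, either
     v = t and the loop is a C-loop, or s, w give the four triples of (b). *)
  case: b sqF sqC => [/(_ isT) sqF | _] sqC.
    apply: Or44; split=> //.
      apply/abelem2_central_quotient.
      by case: sqC => //; rewrite !orbT.
    rewrite tE as_ !inE.
    by case: (s) (w) (v) => [] [] []; rewrite eqxx ?orbT.
  have [vt|neq_vt] := eqVneq v t; first by apply/Or41/C_bits => //; left.
  (* The exceptional case s = w = v = 0 has v = t, so it is excluded. *)
  have sqC' : forall x : gT, central (x * x).
    by case: sqC => //; move: neq_vt; rewrite tE; case: (s) (w) (v) => [] [] [].
  apply: Or42; split; first exact/abelem2_central_quotient.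
  move: neq_vt; rewrite tE as_ !inE.
  by case: (s) (w) (v) => [] [] [] //= _; rewrite eqxx ?orbT.
- move: clp; rewrite bE cE dE.
  case/bits_of_C_loop => // as_ bF tE sqC; apply: RC_bits => //.
  by rewrite bF.
(* The bits are passed in the order s, w, v, a, b, t. *)
- rewrite !inE => /or4P[]/eqP[-> -> ->].
  + by apply: (RC_bits false false true false false false); [| left | | left].
  + by apply: (RC_bits true false false true false true); [| left | | left].
  + by apply: (RC_bits false true false false false true); [| left | | left].
  + by apply: (RC_bits true true true true false false); [| left | | left].
- rewrite !inE => /orP[]/eqP[-> -> ->].
  + by apply: (RC_bits false false false false true false); [| left | | left].
  (* Here t = 0 differs from s + w = 1, so commutativity is invoked. *)
  + by apply: (RC_bits true false false true true false); [| right | | left].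
- rewrite !inE => /or4P[/eqP|/eqP|/eqP|/or4P[/eqP|/eqP|/eqP|/orP[]/eqP]].
  all: move=> [-> -> ->].
  + by apply: (RC_bits false false false false true false); [| left | | left].
  + by apply: (RC_bits false false true false true false); [| left | | left].
  + by apply: (RC_bits true false false true true true); [| left | | left].
  + by apply: (RC_bits true false true true true true); [| left | | left].
  + by apply: (RC_bits false true false false true true); [| left | | left].
  + by apply: (RC_bits false true true false true true); [| left | | left].
  + by apply: (RC_bits true true false true true false); [| left | | left].
  + by apply: (RC_bits true true true true true false); [| left | | left].
Qed.
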